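(* Let $T>0$, $x_0\in\mathbb{R}$, $\gamma_P,\gamma_A>0$, and let $(W,a)\in\mathcal{C}$. Then the inequality $$\mathbb{E}\left[U_P\left(X_T^a-W\right)\right]\leq -\,\mathbb{E}\left[\left|U_P\left(X_T^a-\int_0^T\kappa(a_t)\,dt\right)\right|^{\frac{\gamma_A}{\gamma_A+\gamma_P}}\right]^{\frac{\gamma_A+\gamma_P}{\gamma_A}}\times\left(-\mathbb{E}\left[U_A\left(W-\int_0^T\kappa(a_t)\,dt\right)\right]\right)^{-\frac{\gamma_P}{\gamma_A}}$$ (which always holds) is an equality if and only if there exists a constant $\alpha>0$ such that $$\frac{U_P'\left(X_T^a-W\right)}{U_A'\left(W-\int_0^T\kappa(a_t)\,dt\right)}=\alpha,\quad \mathbb{P}\text{-a.s.}$$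
   Context: Fix $T>0$. Let $(\Omega,\mathcal{F},\mathbb{P})$ be a probability space carrying a standard one-dimensional Brownian motion $B=(B_t)_{t\in[0,T]}$, and let $\mathbb{F}=(\mathcal{F}_t)_{t\in[0,T]}$ be its natural completed filtration. Let $\mathbb{H}_2$ be the set of $\mathbb{F}$-predictable processes $a=(a_t)_{t\in[0,T]}$ with values in $[0,\infty)$ such that $\mathbb{E}[\exp(q\int_0^T|a_t|^2dt)]<\infty$ for all $q>0$. For $a\in\mathbb{H}_2$ and a fixed $x_0\in\mathbb{R}$, set $X_t^a=x_0+\int_0^t a_s\,ds+B_t$. Let $\mathcal{W}$ be the set of $\mathcal{F}_T$-measurable random variables $W$ with $\mathbb{E}[\exp(qW)]<\infty$ for all $q\in\mathbb{R}\setminus\{0\}$, and $\mathcal{C}=\{(W,a):W\in\mathcal{W},a\in\mathbb{H}_2\}$. The cost function $\kappa:[0,\infty)\to\mathbb{R}$ is strictly convex, continuous, non-decreasing, with invertible derivative $\kappa'$. With $\gamma_P,\gamma_A>0$, $U_P(x)=-\exp(-\gamma_P x)$ and $U_A(x)=-\exp(-\gamma_A x)$. *)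

(* Defs.v *)
From HB Require Import structures.
From mathcomp Require Import all_boot all_order all_algebra.
From mathcomp Require Import all_classical all_reals all_analysis.
Set Implicit Arguments.
Unset Strict Implicit.
Unset Printing Implicit Defensive.
Import Order.TTheory GRing.Theory Num.Theory.
Import numFieldNormedType.Exports.
Local Open Scope classical_set_scope.
Local Open Scope ring_scope.

Section defs.
Context {R : realType} {d : measure_display} {Omega : measurableType d}.
Variable P : probability Omega R.
Local Notation mu := (@lebesgue_measure R).

Definition complete_prob :=
  forall N : set Omega, measurable N -> P N = 0%E ->
    forall M, M `<=` N -> measurable M.

Definition mutually_independent n (X : 'I_n -> Omega -> R) :=
  forall A : 'I_n -> set R, (forall i, measurable (A i)) ->
    P (\bigcap_(i in [set: 'I_n]) (X i @^-1` A i)) =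
    (\prod_(i < n) P (X i @^-1` A i))%E.

Definition brownian_motion (T : R) (B : R -> Omega -> R) :=
  [/\ forall w, B 0 w = 0,
      forall t, 0 <= t -> t <= T -> measurable_fun setT (B t),
      forall w, {within `[0, T], continuous (fun t => B t w)},
      forall s t, 0 <= s -> s < t -> t <= T -> forall A : set R, measurable A ->
        P ((fun w => B t w - B s w) @^-1` A) = normal_prob 0 (Num.sqrt (t - s)) A &
      forall n (ts : 'I_n.+1 -> R), 0 <= ts ord0 ->
        (forall i : 'I_n, ts (widen_ord (leqnSn n) i) < ts (lift ord0 i)) ->
        ts ord_max <= T ->
        mutually_independent
          (fun i : 'I_n => fun w => B (ts (lift ord0 i)) w - B (ts (widen_ord (leqnSn n) i)) w)].

Definition nat_gen (B : R -> Omega -> R) (t : R) : set (set Omega) :=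
  [set E | exists s (A : set R), [/\ 0 <= s, s <= t, measurable A & E = B s @^-1` A]].

Definition natural_filtration (B : R -> Omega -> R) (t : R) : set (set Omega) :=
  [set E | exists G N, [/\ <<s nat_gen B t >> G, measurable N, P N = 0%E &
                           (E `\` G) `|` (G `\` E) `<=` N]].

Definition predictable_gen (B : R -> Omega -> R) (T : R) : set (set (R * Omega)) :=
  [set E | (exists A, natural_filtration B 0 A /\ E = [set 0] `*` A) \/
           (exists s t A, [/\ 0 <= s, s < t, t <= T, natural_filtration B s A &
                              E = `]s, t] `*` A])].

Definition predictable (B : R -> Omega -> R) (T : R) (a : R -> Omega -> R) :=
  forall A : set R, measurable A ->
    <<s predictable_gen B T >> ((`[0, T] `*` setT) `&` [set p | A (a p.1 p.2)]).

Definition H2 (B : R -> Omega -> R) (T : R) (a : R -> Omega -> R) :=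
  [/\ predictable B T a,
      (forall t w, 0 <= t -> t <= T -> 0 <= a t w) &
      forall q : R, 0 < q ->
        (\int[P]_w expeR (q%:E * \int[mu]_(t in `[0%R, T]) ((a t w) ^+ 2)%:E) < +oo)%E].

Definition Wclass (B : R -> Omega -> R) (T : R) (W : Omega -> R) :=
  (forall A : set R, measurable A -> natural_filtration B T (W @^-1` A)) /\
  (forall q : R, q != 0 -> (\int[P]_w (expR (q * W w))%:E < +oo)%E).

Definition XT (B : R -> Omega -> R) (T x0 : R) (a : R -> Omega -> R) (w : Omega) : \bar R :=
  ((x0 + B T w)%:E + \int[mu]_(s in `[0%R, T]) (a s w)%:E)%E.

Definition cost (T : R) (kappa : R -> R) (a : R -> Omega -> R) (w : Omega) : \bar R :=
  (\int[mu]_(t in `[0%R, T]) (kappa (a t w))%:E)%E.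

End defs.

Definition Uexp {R : realType} (gamma : R) (x : \bar R) : \bar R :=
  (- expeR (- gamma%:E * x))%E.
Definition Uexp' {R : realType} (gamma : R) (x : \bar R) : \bar R :=
  (gamma%:E * expeR (- gamma%:E * x))%E.

Definition cost_function {R : realType} (kappa : R -> R) :=
  [/\ (forall x y l : R, 0 <= x -> 0 <= y -> x != y -> 0 < l -> l < 1 ->
         kappa (l * x + (1 - l) * y) < l * kappa x + (1 - l) * kappa y),
      {within `[0, +oo[, continuous kappa},
      (forall x y : R, 0 <= x -> x <= y -> kappa x <= kappa y),
      {in `]0, +oo[, forall x, derivable kappa x 1} &
      {in `]0, +oo[ &, injective (derive1 kappa)}].

(* Main.v *)
(** With [t = gA / (gA + gP)], the random variable inside the first expectation
    of the right-hand side is [p^t * q^(1-t)], where [p = exp (- gP (X - W))] and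
    [q = exp (- gA (W - C))]; the contract [W] cancels because
    [t * gP = (1 - t) * gA]. The inequality is Hoelder's, and since [p] and [q]
    are exponentials it follows, with its equality case, from the strict convexity
    of [exp] applied after normalizing [p] and [q] to have expectation 1: equality
    holds iff [p / E p = q / E q] almost surely, that is iff [p] and [q] are
    proportional.
    The expectation of [p] is always finite, by the Gaussian law of [B T] and
    [a >= 0], but the cost [C], hence the expectation of [q], may be infinite.
    In that case the right-hand side is 0, so the inequality is strict, while
    proportionality to [p] would make [q] integrable. *)
Require Import Defs.
From HB Require Import structures.
From mathcomp Require Import all_boot all_order all_algebra.
From mathcomp Require Import all_classical all_reals all_analysis.
From mathcomp Require Import measurable_realfun ring lra.
Import Order.TTheory GRing.Theory Num.Theory.
Import numFieldNormedType.Exports.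
Local Open Scope classical_set_scope.
Local Open Scope ring_scope.

(** * Strict convexity of the exponential, and Hoelder's inequality with its equality case *)

Lemma expR_tangent {R : realType} (m u : R) :
  expR m * (1 + (u - m)) <= expR u ?= iff (u == m).
Proof.
have -> : expR u = expR m * expR (u - m) by rewrite -expRD subrKC.
split; first by rewrite ler_pM2l ?expR_gt0// expR_ge1Dx.
have [->|um] := eqVneq u m; first by rewrite subrr addr0 expR0 eqxx.
by apply/negbTE; rewrite lt_eqF// ltr_pM2l ?expR_gt0// expR_gt1Dx// subr_eq0.
Qed.

(** Average the tangent bounds at the barycentre [m] of [u] and [v]: the linear terms cancel,
    because [t * (u - m) + (1 - t) * (v - m) = 0]. *)
Lemma expR_strictly_convex {R : realType} (t u v : R) : 0 < t -> t < 1 ->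
  expR (t * u + (1 - t) * v) <= t * expR u + (1 - t) * expR v ?= iff (u == v).
Proof.
move=> t0 t1; set m := t * u + (1 - t) * v.
have [lu eu] := expR_tangent m u; have [lv ev] := expR_tangent m v.
have mE : expR m =
    t * (expR m * (1 + (u - m))) + (1 - t) * (expR m * (1 + (v - m))).
  by rewrite /m; ring.
have t1' : 0 < 1 - t by rewrite subr_gt0.
split.
  rewrite {1}mE lerD// ?ler_pM2l//.
have [uv|uv] := eqVneq u v.
  by rewrite /m uv -!mulrDl subrKC !mul1r eqxx.
(* One strict tangent bound is enough: [u = m] would force [u = v], as [1 - t] is nonzero. *)
apply/negbTE; rewrite lt_eqF// {1}mE ltr_leD// ?ler_pM2l// ltr_pM2l//.
rewrite lt_neqAle lu andbT eu; apply: contra_neq uv => um.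
have : (1 - t) * (u - v) = 0.
  have -> : (1 - t) * (u - v) = u - m by rewrite /m; ring.
  by rewrite {1}um subrr.
by move/eqP; rewrite mulf_eq0 gt_eqF//= subr_eq0 => /eqP.
Qed.

Section exp_hoelder.
Local Open Scope ereal_scope.
Context {d} {T : measurableType d} {R : realType}.
Variable mu : {measure set T -> \bar R}.
Variables (t F G : R) (u v : T -> R).
Hypotheses (t0 : (0 < t)%R) (t1 : (t < 1)%R) (F0 : (0 < F)%R) (G0 : (0 < G)%R).
Hypotheses (meas_u : measurable_fun setT u) (meas_v : measurable_fun setT v).
Hypothesis intu : \int[mu]_x (expR (u x))%:E = F%:E.
Hypothesis intv : \int[mu]_x (expR (v x))%:E = G%:E.

(** After normalization the geometric mean [h] lies below the arithmetic mean [k], whose integral is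
    1. The defect in the inequality is thus proportional to the integral of [k - h >= 0], which
    vanishes exactly when [h = k] almost everywhere. *)
Lemma exp_hoelder :
  \int[mu]_x (expR (t * u x + (1 - t) * v x))%:E <= (F `^ t * G `^ (1 - t))%:E
  /\ (\int[mu]_x (expR (t * u x + (1 - t) * v x))%:E
        = (F `^ t * G `^ (1 - t))%:E <->
      {ae mu, forall x, (u x - ln F = v x - ln G)%R}).
Proof.
(* Here [p] and [q] are exponents: subtracting [ln F] and [ln G] divides the exponentials by their
   integrals. *)
pose p x : R := (u x - ln F)%R; pose q x : R := (v x - ln G)%R.
have mp : measurable_fun setT p by exact: measurable_funB.
have mq : measurable_fun setT q by exact: measurable_funB.
pose h x : R := expR (t * p x + (1 - t) * q x).
pose k x : R := (t * expR (p x) + (1 - t) * expR (q x))%R.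
have mh : measurable_fun setT h.
  by apply: measurableT_comp => //; apply: measurable_funD; exact: measurable_funM.
have mk : measurable_fun setT k.
  by apply: measurable_funD; apply: measurable_funM => //; exact: measurableT_comp.
have hk x := expR_strictly_convex t (p x) (q x) t0 t1.
have FGE : (F `^ t * G `^ (1 - t) = expR (t * ln F + (1 - t) * ln G))%R.
  by rewrite /powR !gt_eqF// expRD.
have FG0 : (0 < F `^ t * G `^ (1 - t))%R by rewrite FGE expR_gt0.
have -> : \int[mu]_x (expR (t * u x + (1 - t) * v x))%:E =
    (F `^ t * G `^ (1 - t))%:E * \int[mu]_x (h x)%:E.
  rewrite -ge0_integralZl//; last 3 first.
  - exact/measurable_EFinP.
  - by move=> x _; rewrite lee_fin expR_ge0.
  - by rewrite lee_fin ltW.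
  apply: eq_integral => x _; rewrite -EFinM FGE /h -expRD; congr (expR _)%:E.
  by rewrite /p /q; ring.
have int_exp w c : (0 < c)%R -> measurable_fun setT w ->
    \int[mu]_x (expR (w x))%:E = c%:E ->
    \int[mu]_x (expR (w x - ln c))%:E = 1.
  move=> c0 mw wc.
  under eq_integral do rewrite expRD expRN lnK ?posrE// mulrC EFinM.
  rewrite ge0_integralZl ?wc//.
  - by rewrite -EFinM mulVf ?gt_eqF.
  - exact/measurable_EFinP/measurableT_comp.
  - by rewrite lee_fin invr_ge0 ltW.
have intk : \int[mu]_x (k x)%:E = 1.
  under eq_integral do rewrite EFinD !EFinM.
  rewrite ge0_integralD//; last 4 first.
  - by move=> x _; rewrite -EFinM lee_fin mulr_ge0 ?expR_ge0 ?ltW.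
  - by apply/measurable_EFinP; apply: measurable_funM => //; exact: measurableT_comp.
  - by move=> x _; rewrite -EFinM lee_fin mulr_ge0 ?expR_ge0 ?subr_ge0 ?ltW.
  - by apply/measurable_EFinP; apply: measurable_funM => //; exact: measurableT_comp.
  rewrite !ge0_integralZl//; last 4 first.
  - exact/measurable_EFinP/measurableT_comp.
  - by rewrite lee_fin subr_ge0 ltW.
  - exact/measurable_EFinP/measurableT_comp.
  - by rewrite lee_fin ltW.
  by rewrite !int_exp// !mule1 -EFinD subrKC.
have kh x : (0 <= k x - h x)%R by rewrite subr_ge0 (hk x).1.
(* Stated as a sum, since the finiteness of the integral of [h] is deduced from this identity. *)
have hkD : \int[mu]_x (h x)%:E + \int[mu]_x (k x - h x)%:E = 1.
  transitivity (\int[mu]_x ((h x)%:E + (k x - h x)%:E)); last first.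
    by rewrite -intk; apply: eq_integral => x _; rewrite -EFinD subrKC.
  rewrite ge0_integralD//.
  - by move=> x _; rewrite lee_fin expR_ge0.
  - exact/measurable_EFinP.
  - by move=> x _; rewrite lee_fin.
  - exact/measurable_EFinP/measurable_funB.
have h0 : 0 <= \int[mu]_x (h x)%:E.
  by apply: integral_ge0 => x _; rewrite lee_fin expR_ge0.
have kh0 : 0 <= \int[mu]_x (k x - h x)%:E.
  by apply: integral_ge0 => x _; rewrite lee_fin.
have h1 : \int[mu]_x (h x)%:E <= 1 by rewrite -hkD leeDl.
have hfin : \int[mu]_x (h x)%:E \is a fin_num.
  by rewrite ge0_fin_numE// (le_lt_trans h1)// ltry.
split; first by rewrite -[leRHS]mule1 lee_pmul2l.
have -> : (F `^ t * G `^ (1 - t))%:E * \int[mu]_x (h x)%:E =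
    (F `^ t * G `^ (1 - t))%:E <-> \int[mu]_x (k x - h x)%:E = 0.
  split=> H0; last by move: hkD; rewrite H0 adde0 => ->; rewrite mule1.
  move: H0; rewrite -(fineK hfin) -EFinM => -[H0].
  have h_1 : fine (\int[mu]_x (h x)%:E) = 1%R.
    by apply: (mulfI (lt0r_neq0 FG0)); rewrite mulr1.
  move: hkD; rewrite -(fineK hfin) h_1.
  by case: (\int[mu]_x _) kh0 => //= r _ [] /eqP; rewrite -[X in _ == X]addr0 (inj_eq (addrI _)) => /eqP ->.
have -> : \int[mu]_x (k x - h x)%:E = \int[mu]_x `|(k x - h x)%:E|.
  by apply: eq_integral => x _; rewrite gee0_abs// lee_fin.
rewrite ae_eq_integral_abs//; last exact/measurable_EFinP/measurable_funB.
split; apply: filterS => x /=.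
  move=> /(_ I)[] /eqP; rewrite subr_eq0 eq_sym (hk x).2 => /eqP//.
move=> pq _; congr EFin; apply/eqP; rewrite subr_eq0 eq_sym (hk x).2.
exact/eqP.
Qed.

End exp_hoelder.

(** * Exponential moments of the Gaussian law and of [B T] *)

(** The Radon-Nikodym derivative of the normal law and the explicit density have the same integral
    over every measurable set, so they agree almost everywhere. *)
Lemma ge0_integral_normal_prob {R : realType} (m s : R) (f : R -> \bar R) :
  (forall x, 0 <= f x)%E -> measurable_fun setT f ->
  (\int[normal_prob m s]_x f x =
   \int[lebesgue_measure]_x (f x * (normal_pdf m s x)%:E))%E.
Proof.
move=> f0 mf; have dom := normal_prob_dominates m s.
rewrite -(Radon_Nikodym_SigmaFinite.change_of_variables dom)//.
have fint := Radon_Nikodym_SigmaFinite.f_integrable dom.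
have mpdf : measurable_fun setT (fun x => (normal_pdf m s x)%:E).
  by apply/measurable_EFinP; exact: measurable_normal_pdf.
apply: ae_eq_integral => //.
- by apply: emeasurable_funM => //; exact: measurable_int fint.
- exact: emeasurable_funM.
- apply: ae_eqe_mul2l; apply: integral_ae_eq => // E _ mE.
  by rewrite -Radon_Nikodym_SigmaFinite.f_integral.
Qed.

(** Completing the square turns [expR (c * x)] times the centred density into a constant times the
    density of mean [c * s ^+ 2], which has total mass 1. *)
Lemma integral_expR_normal_prob {R : realType} (s c : R) : s != 0 ->
  (\int[normal_prob 0 s]_x (expR (c * x))%:E =
   (expR (c ^+ 2 * s ^+ 2 / 2))%:E)%E.
Proof.
move=> s0; rewrite ge0_integral_normal_prob//; last first.
  by apply/measurable_EFinP/measurableT_comp => //; exact: measurable_funM.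
rewrite -[RHS]mule1 -(integral_normal_pdf (c * s ^+ 2) s) -ge0_integralZl//.
- apply: eq_integral => x _; rewrite -!EFinM !normal_pdfE// /normal_fun; congr EFin.
  rewrite mulrCA [RHS]mulrCA; congr (_ * _); rewrite -!expRD; congr expR.
  by field.
- by apply/measurable_EFinP; exact: measurable_normal_pdf.
- by move=> x _; rewrite lee_fin normal_pdf_ge0.
Qed.

(* [normal_prob] and [lebesgue_measure] live on [measurableTypeR R], whose display
   differs from that of the canonical measurable structure of [R]; hence the
   explicit types of the measurability facts here and below. *)
Lemma brownian_expR_integrable {R : realType} d (Omega : measurableType d)
    (P : probability Omega R) (T : R) (B : R -> Omega -> R) (c : R) :
  0 < T -> brownian_motion P T B -> (\int[P]_w (expR (c * B T w))%:E < +oo)%E.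
Proof.
move=> T0 [B0 mB _ gaussB _].
have mBT : @measurable_fun _ _ Omega (measurableTypeR R) setT (B T).
  by apply: mB => //; exact: ltW.
pose X : {mfun Omega >-> measurableTypeR R} :=
  HB.pack (B T : Omega -> measurableTypeR R) (isMeasurableFun.Build _ _ _ _ _ mBT).
have XE A : measurable A -> distribution P X A = normal_prob 0 (Num.sqrt T) A.
  (* As [B 0 = 0], the law of [B T] is that of the increment from 0 to [T]. *)
  move=> mA; rewrite -[T in Num.sqrt T]subr0 -(gaussB 0 T)//.
  by congr (P _); apply/seteqP; split => w /=; rewrite B0 subr0.
have mexp : measurable_fun setT (fun x : measurableTypeR R => (expR (c * x))%:E).
  by apply/measurable_EFinP/measurableT_comp => //; exact: measurable_funM.
rewrite -(@ge0_integral_distribution _ _ _ _ _ P X (fun x => (expR (c * x))%:E))//.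
rewrite (eq_measure_integral (normal_prob 0 (Num.sqrt T))); last first.
  by move=> A mA _; exact: XE.
by rewrite integral_expR_normal_prob ?ltry// gt_eqF// sqrtr_gt0.
Qed.

(** * Measurability of controls and of their time integrals *)

Section brownian_measurability.
Context {R : realType} {d : measure_display} {Omega : measurableType d}.
Variables (P : probability Omega R) (T : R) (B : R -> Omega -> R).
Hypotheses (T0 : 0 <= T) (Pc : complete_prob P) (BM : brownian_motion P T B).

(** A set of the completed filtration differs from a generated one by subsets of a null set, which
    are measurable by completeness of [P]. *)
Lemma natural_filtration_measurable t : t <= T ->
  natural_filtration P B t `<=` measurable.
Proof.
move=> tT E [G [N [sG mN PN EGN]]].
have mG : measurable G.
  move: G sG {EGN}; apply: smallest_sub; first exact: sigma_algebra_measurable.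
  move=> _ [s [A [s0 st mA ->]]]; have [_ mB _ _ _] := BM.
  by rewrite -[X in measurable X]setTI; apply: mB => //; exact: le_trans tT.
have mEG : measurable (E `\` G).
  by apply: (Pc N mN PN) => w EGw; apply: EGN; left.
have mGE : measurable (G `\` E).
  by apply: (Pc N mN PN) => w EGw; apply: EGN; right.
have -> : E = (G `\` (G `\` E)) `|` (E `\` G).
  by rewrite setDD setIC setUIDK.
by apply: measurableU => //; exact: measurableD.
Qed.

(** Provides the joint measurability needed for Tonelli's theorem: both kinds of generators are
    rectangles with measurable sides. *)
Lemma predictable_measurable (a : R -> Omega -> R) : predictable P B T a ->
  measurable_fun (`[0, T] `*` setT) (fun p : R * Omega => a p.1 p.2).
Proof.
move=> pa _ A mA; move: (pa A mA); apply: smallest_sub.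
  exact: sigma_algebra_measurable.
move=> _ [[E [FE ->]]|[s [t [E [s0 st tT FE ->]]]]].
- apply: measurableX => //; apply: natural_filtration_measurable FE.
  exact: T0.
- apply: measurableX => //; apply: natural_filtration_measurable FE.
  by rewrite (le_trans _ tT)// ltW.
Qed.

End brownian_measurability.

Lemma measurable_expeR {R : realType} : measurable_fun setT (@expeR R).
Proof.
rewrite (_ : expeR = fun x => if x == +oo%E then +oo%E
    else if x == -oo%E then 0%E else (expR (fine x))%:E); last first.
  by apply/funext; case.
apply: measurable_fun_ifT => //=; first exact: measurable_fun_eqe.
apply: measurable_fun_ifT => //=; first exact: measurable_fun_eqe.
by apply/measurable_EFinP => //=; exact: measurableT_comp.
Qed.

Lemma measurable_fun_integral_section {R : realType} {d : measure_display}
    {Omega : measurableType d} (D : set R) (g : R * Omega -> R) :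
  measurable D -> measurable_fun (D `*` setT) g ->
  (forall w, @measurable_fun _ _ (measurableTypeR R) _ D
    (fun t => (g (t, w))%:E)) /\
  measurable_fun setT
    (fun w => \int[lebesgue_measure]_(t in D) (g (t, w))%:E)%E.
Proof.
move=> mD mg; pose h := (EFin \o g) \_ (D `*` setT).
have mDT : @measurable _ (measurableTypeR R * Omega)%type (D `*` setT).
  exact: measurableX.
have mg' : @measurable_fun _ _ (measurableTypeR R * Omega)%type _ (D `*` setT) g.
  exact: mg.
have mh : @measurable_fun _ _ (measurableTypeR R * Omega)%type _ setT h.
  by apply/(measurable_restrictT _ mDT)/measurable_EFinP.
have hE w : (fun t => h (t, w)) = (EFin \o (fun t => g (t, w))) \_ D.
  apply/funext => t; rewrite /h /patch; congr (if _ then _ else _).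
  by rewrite in_setX in_setT andbT.
split=> [w|].
  apply: (iffRL (@measurable_restrictT _ _ (measurableTypeR R) _ D _ _)) => //.
  by rewrite -[X in X \_ D]/(EFin \o _) -hE; exact: measurable_fun_pair1 mh.
(* Tonelli's theorem needs a nonnegative integrand, so it is applied to the positive and negative
   parts of the extension [h] of [g] by 0. *)
have -> : (fun w => \int[lebesgue_measure]_(t in D) (g (t, w))%:E)%E =
    (fubini_G lebesgue_measure (h^\+)%E \- fubini_G lebesgue_measure (h^\-)%E)%E.
  apply/funext => w; transitivity (\int[lebesgue_measure]_t h (t, w))%E.
    by rewrite integral_mkcond -[fun t => (g (t, w))%:E]/(EFin \o _) -hE.
  rewrite integralE; congr (_ - _)%E; apply: eq_integral => t _.
    by rewrite !funeposE.
  by rewrite !funenegE.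
apply: emeasurable_funB; apply: measurable_fun_fubini_tonelli_G => //.
- exact: measurable_funepos.
- exact: measurable_funeneg.
Qed.

(** * Finiteness and measurability of the state and of the cost *)

Section state_and_cost.
Context {R : realType} {d : measure_display} {Omega : measurableType d}.
Variables (P : probability Omega R) (T : R) (a : R -> Omega -> R).
Hypotheses (T0 : 0 <= T)
  (ma : measurable_fun (`[0, T] `*` setT) (fun p : R * Omega => a p.1 p.2))
  (a0 : forall t w, 0 <= t -> t <= T -> 0 <= a t w).
Local Notation mu := (@lebesgue_measure R).

Lemma ae_integral_control_lty (q : R) : 0 < q ->
  (\int[P]_w expeR (q%:E * \int[mu]_(t in `[0%R, T]) ((a t w) ^+ 2)%:E) < +oo)%E ->
  {ae P, forall w, (\int[mu]_(t in `[0%R, T]) (a t w)%:E < +oo)%E}.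
Proof.
move=> q0 expoo.
have [msec _] := measurable_fun_integral_section `[0, T]%classic _ (measurable_itv _) ma.
have [m2sec m2] := measurable_fun_integral_section `[0, T]%classic
  (fun p => a p.1 p.2 ^+ 2) (measurable_itv _) (measurable_funX _ ma).
have mexp : measurable_fun setT
    (fun w => expeR (q%:E * \int[mu]_(t in `[0%R, T]) ((a t w) ^+ 2)%:E))%E.
  apply: measurableT_comp; first exact: measurable_expeR.
  exact: measurable_funeM.
have : P.-integrable setT
    (fun w => expeR (q%:E * \int[mu]_(t in `[0%R, T]) ((a t w) ^+ 2)%:E))%E.
  apply/integrableP; split=> //; under eq_integral do rewrite gee0_abs ?expeR_ge0//.
  exact: expoo.
move/(integrable_ae measurableT); apply: filterS => w /= /(_ I) fin.
have fin2 : (\int[mu]_(t in `[0%R, T]) ((a t w) ^+ 2)%:E < +oo)%E.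
  rewrite ltNge leye_eq; apply: contraTN fin => /eqP ->.
  by rewrite gt0_muley.
(* Square integrability yields integrability on a bounded interval, through [a <= 1 + a ^+ 2]. *)
apply: (@le_lt_trans _ _ (\int[mu]_(t in `[0%R, T]) (1 + ((a t w) ^+ 2)%:E)))%E.
  apply: ge0_le_integral => //.
  - by move=> t /=; rewrite in_itv/= lee_fin => /andP[]; exact: a0.
  - exact: msec.
  - by apply: emeasurable_funD => //; exact: m2sec.
  - by move=> t _; rewrite -EFinD lee_fin; nra.
rewrite ge0_integralD//; last 2 first.
- by move=> t _; rewrite lee_fin sqr_ge0.
- exact: m2sec.
rewrite lte_add_pinfty// integral_cst//= lebesgue_measure_itv/= mul1e.
by case: ifP => _; rewrite ?ltry// -EFinB ltry.
Qed.

(** By monotonicity the running cost is at least [kappa 0], so its negative part has a finite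
    integral over [[0, T]]; the value [+oo] remains possible. *)
Lemma cost_gtNy_measurable (kappa : R -> R) :
  (forall x y : R, 0 <= x -> x <= y -> kappa x <= kappa y) ->
  (forall w, (-oo < cost T kappa a w)%E) /\ measurable_fun setT (cost T kappa a).
Proof.
move=> kappa_nd; (* [kappa] is arbitrary at negative arguments. *)
pose k0 x := kappa (Num.max 0 x).
(* Freezing [kappa] at [kappa 0] on the negative half-line makes it monotone on the whole line,
   hence Borel. *)
have mk0 : measurable_fun setT k0.
  apply: nondecreasing_measurable => // x y xy; apply: kappa_nd.
    by rewrite le_max lexx.
  by rewrite ge_max !le_max lexx xy orbT.
have mka : measurable_fun (`[0, T] `*` setT) (fun p : R * Omega => k0 (a p.1 p.2)).
  exact: measurableT_comp mk0 ma.
have k0E t w : 0 <= t <= T -> k0 (a t w) = kappa (a t w).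
  by move=> /andP[t0 tT]; rewrite /k0 (max_idPr (a0 t w t0 tT)).
have costE w : (cost T kappa a w = \int[mu]_(t in `[0%R, T]) (k0 (a t w))%:E)%E.
  by apply: eq_integral => t; rewrite inE/= in_itv/= => tT; rewrite k0E.
have [msec mint] := measurable_fun_integral_section `[0, T]%classic _ (measurable_itv _) mka.
split; last by rewrite (funext costE).
move=> w; rewrite costE integralE.
set I1 := (\int[_]_(_ in _) _)%E; set I2 := (\int[_]_(_ in _) _)%E.
have I10 : (0 <= I1)%E by apply: integral_ge0.
suff I2fin : (I2 < +oo)%E.
  rewrite (@lt_le_trans _ _ (0 - I2)%E)//; last exact: leeB.
  by rewrite sub0e ltNye eqe_oppLR lt_eqF.
apply: (@le_lt_trans _ _ (\int[mu]_(t in `[0%R, T]) (`|k0 0|)%:E)%E).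
  apply: ge0_le_integral => //.
  - by apply: measurable_funeneg; exact: msec.
  - move=> t; rewrite /= in_itv/= => /andP[t0 tT].
    rewrite funenegE ge_max -EFinN !lee_fin normr_ge0 andbT.
    apply: (@le_trans _ _ (- k0 0)); last by rewrite -normrN ler_norm.
    by rewrite lerN2 k0E ?t0// /k0 maxxx; apply: kappa_nd => //; exact: a0.
rewrite integral_cst//= lebesgue_measure_itv/=.
by case: ifP => _; rewrite ?mule0 -?EFinB -?EFinM ltry.
Qed.

End state_and_cost.

(** Raising to the power [t^-1] and isolating [F] gives Hoelder's bound the shape of the utility
    inequality: for [t = gA / (gA + gP)], the exponents [t^-1] and [(1 - t) / t] are
    [(gA + gP) / gA] and [gP / gA]. *)
Lemma powR_hoelder_rearrange {R : realType} (t e F G : R) :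
  0 < t -> 0 <= e -> 0 < F -> 0 < G ->
  (e <= F `^ t * G `^ (1 - t)) = (e `^ t^-1 * (G `^ ((1 - t) / t))^-1 <= F) /\
  (e = F `^ t * G `^ (1 - t) <-> e `^ t^-1 * (G `^ ((1 - t) / t))^-1 = F).
Proof.
move=> t0 e0 F0 G0; set K := F `^ t * G `^ (1 - t).
have K0 : 0 <= K by rewrite mulr_ge0 ?powR_ge0.
have Gp : 0 < G `^ ((1 - t) / t) by rewrite powR_gt0.
have KE : K `^ t^-1 = F * G `^ ((1 - t) / t).
  by rewrite powRM ?powR_ge0// -!powRrM divff ?gt_eqF// powRr1// ltW.
have ti0 : 0 < t^-1 by rewrite invr_gt0.
split.
  rewrite ler_pdivrMr// -KE; apply/idP/idP => [eK|].
    by apply: ge0_ler_powR => //; rewrite ?nnegrE// ltW.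
  by apply: contraTT; rewrite -!ltNge => Ke; apply: gt0_ltr_powR.
split=> [->|/(congr1 (fun z => z * G `^ ((1 - t) / t)))].
  by rewrite KE mulfK// gt_eqF.
rewrite divfK ?gt_eqF// -KE => /(congr1 (fun z => z `^ t)).
by rewrite -!powRrM mulVf ?gt_eqF// !powRr1.
Qed.

(** A zero integral would make [f] vanish almost everywhere, so the whole space would be null. *)
Lemma ge0_integral_gt0 {R : realType} {d : measure_display} {Omega : measurableType d}
    (P : probability Omega R) (f : Omega -> \bar R) :
  measurable_fun setT f -> (forall w, 0 <= f w)%E ->
  {ae P, forall w, 0 < f w}%E -> (0 < \int[P]_w f w)%E.
Proof.
move=> mf f0 fpos; rewrite lt0e integral_ge0 ?andbT//; apply/eqP => int0.
have : (\int[P]_w `|f w| = 0)%E.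
  by rewrite -[RHS]int0; apply: eq_integral => w _; rewrite gee0_abs.
move=> /(ae_eq_integral_abs P measurableT mf) fz.
have [N [mN PN NT]] : {ae P, forall w, False}.
  by apply: filterS2 fpos fz => w fw /= /(_ I) fw0; rewrite fw0 ltxx in fw.
have : P [set: Omega] = 0%E.
  by apply: subset_measure0 PN => // w _; apply: NT.
by rewrite probability_setT => /eqP; rewrite eqe oner_eq0.
Qed.

(** * The utility inequality for an abstract state [X] and cost [C] *)

Section exponential_utilities.
Local Open Scope ereal_scope.
Context {R : realType} {d : measure_display} {Omega : measurableType d}.
Variables (P : probability Omega R) (gP gA : R) (X C : Omega -> \bar R) (W : Omega -> R).
Hypotheses (gP0 : (0 < gP)%R) (gA0 : (0 < gA)%R).
Hypotheses (mX : measurable_fun setT X) (mC : measurable_fun setT C)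
  (mW : measurable_fun setT W).
Hypotheses (XNy : forall w, -oo < X w) (CNy : forall w, -oo < C w)
  (Xy : {ae P, forall w, X w < +oo}).
Hypothesis FX : \int[P]_w expeR (- gP%:E * (X w - (W w)%:E)) < +oo.

Let p w := expeR (- gP%:E * (X w - (W w)%:E)).
Let q w := expeR (- gA%:E * ((W w)%:E - C w)).
Let h w := poweR `| Uexp gP (X w - C w) | (gA / (gA + gP)).
Let t : R := (gA / (gA + gP))%R.

Let mp : measurable_fun setT p.
Proof.
apply: measurableT_comp; first exact: measurable_expeR.
apply: measurable_funeM; apply: emeasurable_funB => //.
exact/measurable_EFinP.
Qed.

Let mq : measurable_fun setT q.
Proof.
apply: measurableT_comp; first exact: measurable_expeR.
apply: measurable_funeM; apply: emeasurable_funB => //.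
exact/measurable_EFinP.
Qed.

Let mh : measurable_fun setT h.
Proof.
apply: (measurableT_comp (@measurable_poweR R t)).
apply: measurableT_comp => //; rewrite /Uexp.
apply: (@measurableT_comp _ _ _ _ _ _ (@oppe R)) => //.
apply: measurableT_comp; first exact: measurable_expeR.
by apply: measurable_funeM; exact: emeasurable_funB.
Qed.

Let p0 w : 0 <= p w. Proof. exact: expeR_ge0. Qed.

(** Positivity holds everywhere because [C] avoids [-oo]; where [C] is [+oo], so is [q]. By contrast
    [p] vanishes where [X] is [+oo]. *)
Let q0 w : 0 < q w.
Proof.
rewrite expeR_gt0// -EFinN; case: (C w) (CNy w) => [c| |] // _.
  by rewrite -EFinB -EFinM ltNyr.
by rewrite addeNy lt0_muleNy // lte_fin oppr_lt0.
Qed.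

Let h0 w : 0 <= h w. Proof. exact: poweR_ge0. Qed.

Let F_gt0 : 0 < \int[P]_w p w.
Proof.
apply: ge0_integral_gt0 => //; apply: filterS Xy => w; rewrite /p.
case: (X w) (XNy w) => // x _ _.
by rewrite /= lte_fin expR_gt0.
Qed.

Let G_gt0 : 0 < \int[P]_w q w.
Proof. by apply: ge0_integral_gt0 => //; [move=> w; exact: ltW|exact: aeW]. Qed.

(** Solving the ratio condition for [q] gives the constant [gP / (alpha * gA)]; integrability then
    passes from [p] to [q]. *)
Lemma proportional_integral_lty (alpha : R) : (0 < alpha)%R ->
  {ae P, forall w, Uexp' gP (X w - (W w)%:E)
    * (Uexp' gA ((W w)%:E - C w))^-1 = alpha%:E} ->
  {ae P, forall w, q w = (gP / (alpha * gA))%:E * p w} /\ \int[P]_w q w < +oo.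
Proof.
move=> al0 pq; have {}pq : {ae P, forall w, q w = (gP / (alpha * gA))%:E * p w}.
  apply: filterS pq => w; rewrite /Uexp' -/(p w) -/(q w).
  case: (q w) (q0 w) => [y| |]//; rewrite ?lte_fin => y0.
    case: (p w) (p0 w) => [x| |]// x0.
      rewrite -!EFinM inver mulf_eq0 !gt_eqF//= -EFinM => -[E].
      congr EFin; apply: (mulIf (lt0r_neq0 al0)).
      have gAy : (gA * y != 0)%R by rewrite mulf_neq0// gt_eqF.
      move: (congr1 (fun z => z * (gA * y))%R E); rewrite divfK// => E2.
      apply: (mulIf (lt0r_neq0 gA0)).
      rewrite mulrAC [RHS](_ : _ = gP * x)%R; last by field; rewrite !gt_eqF.
      by rewrite E2; ring.
    rewrite gt0_muley ?lte_fin// -EFinM inver mulf_eq0 !gt_eqF//=.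
    by rewrite gt0_mulye// lte_fin invr_gt0 mulr_gt0.
  (* Where [q] is [+oo] its inverse is 0, so the ratio would be 0 and not [alpha]. *)
  by rewrite gt0_muley ?lte_fin// invey mule0 => -[] E; move: al0; rewrite -E ltxx.
split=> //; rewrite (@ae_eq_integral _ _ _ P setT (fun w => (gP / (alpha * gA))%:E * p w))//.
- rewrite ge0_integralZl//; last by rewrite lee_fin divr_ge0 ?mulr_ge0 ?ltW.
  by rewrite lte_mul_pinfty// lee_fin divr_ge0 ?mulr_ge0 ?ltW.
- exact: measurable_funeM.
- by apply: filterS pq.
Qed.

Lemma exp_utility_hoelder :
  let LHS := \int[P]_w Uexp gP (X w - (W w)%:E) in
  let E1 := \int[P]_w poweR `| Uexp gP (X w - C w) | (gA / (gA + gP)) in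
  let E2 := \int[P]_w Uexp gA ((W w)%:E - C w) in
  let RHS := - (poweR E1 ((gA + gP) / gA) * (poweR (- E2) (gP / gA))^-1) in
  LHS <= RHS /\
  (LHS = RHS <->
   exists alpha : R, (0 < alpha)%R /\
     {ae P, forall w, Uexp' gP (X w - (W w)%:E)
                       * (Uexp' gA ((W w)%:E - C w))^-1 = alpha%:E}).
Proof.
move=> LHS E1 E2 RHS.
have LHSE : LHS = - \int[P]_w p w by rewrite /LHS /Uexp integral_ge0N// => w _; exact: p0.
have E2E : - E2 = \int[P]_w q w.
  by rewrite /E2 /Uexp integral_ge0N ?oppeK// => w _; exact/ltW/q0.
have gPA0 : (0 < gA + gP)%R by rewrite addr_gt0.
have t0 : (0 < t)%R by rewrite divr_gt0.
have t1 : (t < 1)%R by rewrite ltr_pdivrMr// mul1r ltrDl.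
have tVE : ((gA + gP) / gA = t^-1)%R by rewrite invf_div.
have tCE : (gP / gA = (1 - t) / t)%R.
  by rewrite /t; field; rewrite !gt_eqF.
have Ffin : \int[P]_w p w = (fine (\int[P]_w p w))%:E.
  by rewrite fineK// ge0_fin_numE// ltW.
have [Gy|] := eqVneq (\int[P]_w q w) +oo.
  (* The inverse of [+oo] is 0, and the product with 0 is 0 even if [E1] is [+oo]. *)
  have RHS0 : RHS = 0.
    by rewrite /RHS E2E Gy poweRyr ?gt_eqF ?divr_gt0// invey mule0 oppe0.
  rewrite RHS0 LHSE; split; first by rewrite oppe_le0 ltW.
  split=> [/eqP|[alpha [al0 /(proportional_integral_lty alpha al0)[_]]]].
    by rewrite eqe_oppLR oppe0 gt_eqF.
  by rewrite Gy ltxx.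
rewrite -ltey => Gy.
have Gfin : \int[P]_w q w = (fine (\int[P]_w q w))%:E.
  by rewrite fineK// ge0_fin_numE// ltW.
set F : R := fine (\int[P]_w p w) in Ffin.
set G : R := fine (\int[P]_w q w) in Gfin.
have F0 : (0 < F)%R by rewrite -lte_fin -Ffin.
have G0 : (0 < G)%R by rewrite -lte_fin -Gfin.
(* Real-valued versions of the exponents, as required by [exp_hoelder]; they are exact where [X] and
   [C] are finite, that is almost surely. *)
pose u w : R := (- gP * (fine (X w) - W w))%R.
pose v w : R := (- gA * (W w - fine (C w)))%R.
have mu : measurable_fun setT u.
  apply: measurable_funM => //; apply: measurable_funB => //.
  exact: measurableT_comp.
have mv : measurable_fun setT v.
  apply: measurable_funM => //; apply: measurable_funB => //.
  exact: measurableT_comp.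
(* Integrability of [q] forces [q], and hence [C], to be finite almost surely. *)
have Cy : {ae P, forall w, C w < +oo}.
  have qint : P.-integrable setT q.
    apply/integrableP; split => //.
    by under eq_integral do rewrite gee0_abs ?(ltW (q0 _))//.
  apply: filterS (integrable_ae measurableT qint) => w /= /(_ I).
  rewrite /q ltey; apply: contraTN => /eqP ->.
  by rewrite addeNy lt0_muleNy// lte_fin oppr_lt0.
have pu : {ae P, forall w, p w = (expR (u w))%:E}.
  apply: filterS Xy => w; rewrite /p /u.
  by case: (X w) (XNy w).
have qv : {ae P, forall w, q w = (expR (v w))%:E}.
  apply: filterS Cy => w; rewrite /q /v.
  by case: (C w) (CNy w).
have huv : {ae P, forall w, h w = (expR (t * u w + (1 - t) * v w))%:E}.
  apply: filterS2 Xy Cy => w; rewrite /h /u /v /Uexp.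
  case: (X w) (XNy w) => [x| |]// _ _; case: (C w) (CNy w) => [c| |]// _ _.
  rewrite abseN /= ger0_norm ?expR_ge0// /powR gt_eqF ?expR_gt0// expRK.
  by congr (expR _)%:E; rewrite -/t /t; field; rewrite gt_eqF.
have mE (f : Omega -> R) : measurable_fun setT f -> measurable_fun setT (fun w => (expR (f w))%:E).
  by move=> mf; apply/measurable_EFinP/measurableT_comp.
have intu : \int[P]_w (expR (u w))%:E = F%:E.
  rewrite -Ffin; apply/esym/ae_eq_integral => //; first exact: mE.
  by apply: filterS pu.
have intv : \int[P]_w (expR (v w))%:E = G%:E.
  rewrite -Gfin; apply/esym/ae_eq_integral => //; first exact: mE.
  by apply: filterS qv.
have E1E : E1 = \int[P]_w (expR (t * u w + (1 - t) * v w))%:E.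
  apply: ae_eq_integral => //; last by apply: filterS huv.
  by apply: mE; apply: measurable_funD; exact: measurable_funM.
have [hle heq] := exp_hoelder P t F G u v t0 t1 F0 G0 mu mv intu intv.
rewrite -E1E in hle heq.
have E10 : 0 <= E1 by apply: integral_ge0 => w _; exact: h0.
have E1fin : E1 = (fine E1)%:E.
  by rewrite fineK// ge0_fin_numE// (le_lt_trans hle)// ltry.
set e : R := fine E1 in E1fin.
have e0 : (0 <= e)%R by rewrite -lee_fin -E1fin.
have [ele eeq] := powR_hoelder_rearrange t e F G t0 e0 F0 G0.
have RHSE : RHS = - (e `^ t^-1 * (G `^ ((1 - t) / t))^-1)%:E.
  by rewrite /RHS E2E Gfin E1fin tVE tCE !poweR_EFin inver gt_eqF ?powR_gt0.
rewrite LHSE RHSE Ffin; split.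
  by rewrite leeN2 lee_fin -ele -lee_fin -E1fin.
split=> [/oppe_inj[]/esym/eeq eE|].
  have /heq uv : E1 = (F `^ t * G `^ (1 - t))%:E by rewrite E1fin eE.
  (* Equality means [p / F = q / G] almost surely, which fixes the ratio of [gP * p] to [gA * q]. *)
  exists (gP * F / (gA * G))%R; split; first by rewrite divr_gt0// mulr_gt0.
  apply: filterS3 uv pu qv => w uvw puw qvw.
  rewrite /Uexp' -/(p w) -/(q w) puw qvw -!EFinM inver.
  rewrite gt_eqF ?mulr_gt0 ?expR_gt0// -EFinM; congr EFin.
  have -> : u w = (v w + (ln F - ln G))%R by rewrite -[u w](subrK (ln F)) uvw; ring.
  rewrite expRD expRB !lnK ?posrE//; field.
  by rewrite !gt_eqF ?expR_gt0.
move=> [alpha [al0 /(proportional_integral_lty alpha al0)[qp _]]].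
set k := (gP / (alpha * gA))%R in qp.
have k0 : (0 < k)%R by rewrite divr_gt0// mulr_gt0.
(* Integrating [q = k * p] gives [G = k * F], so [k] disappears after normalization. *)
have GF : (G = k * F)%R.
  apply: EFin_inj; rewrite EFinM -Gfin -Ffin -ge0_integralZl//; last first.
    by rewrite lee_fin ltW.
  apply: ae_eq_integral => //; first exact: measurable_funeM.
  by apply: filterS qp.
congr (- _%:E); apply/esym/eeq/EFin_inj; rewrite -E1fin; apply/heq.
apply: filterS3 pu qv qp => w -> -> [] /(congr1 (@ln R)).
rewrite lnM ?posrE ?expR_gt0// !expRK => ->.
by rewrite GF lnM ?posrE//; ring.
Qed.

End exponential_utilities.

(** * Application to the controlled state and its cost *)

Theorem theorem3p3 (R : realType) (d : measure_display) (Omega : measurableType d)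
  (P : probability Omega R) (HPc : complete_prob P)
  (B : R -> Omega -> R) (T x0 gP gA : R) (kappa : R -> R)
  (HT : 0 < T) (HB : brownian_motion P T B) (HgP : 0 < gP) (HgA : 0 < gA)
  (Hkappa : cost_function kappa)
  (W : Omega -> R) (a : R -> Omega -> R)
  (HW : Wclass P B T W) (Ha : H2 P B T a) :
  let LHS := (\int[P]_w Uexp gP (XT B T x0 a w - (W w)%:E))%E in
  let E1 := (\int[P]_w poweR `| Uexp gP (XT B T x0 a w - cost T kappa a w) |
                              (gA / (gA + gP)))%E in
  let E2 := (\int[P]_w Uexp gA ((W w)%:E - cost T kappa a w))%E in
  let RHS := (- (poweR E1 ((gA + gP) / gA) * (poweR (- E2) (gP / gA))^-1))%E in
  (LHS <= RHS)%E /\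
  (LHS = RHS <->
   exists alpha : R, 0 < alpha /\
     {ae P, forall w, (Uexp' gP (XT B T x0 a w - (W w)%:E)
                       * (Uexp' gA ((W w)%:E - cost T kappa a w))^-1 = alpha%:E)%E}).
Proof.
have T0 := ltW HT.
have [Wm Wexp] := HW; have [pa a0 aexp] := Ha; have [_ mB _ _ _] := HB.
have [_ _ kappa_nd _ _] := Hkappa.
have ma := predictable_measurable P T B T0 HPc HB a pa.
have [_ mint] := measurable_fun_integral_section `[0, T]%classic _
  (measurable_itv _) ma.
have [CNy mC] := cost_gtNy_measurable T a ma a0 kappa kappa_nd.
have mW : measurable_fun setT W.
  move=> _ A mA; rewrite setTI.
  exact: natural_filtration_measurable HPc HB _ (lexx T) _ (Wm A mA).
have mBT : measurable_fun setT (B T) by apply: mB.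
have mX : measurable_fun setT (XT B T x0 a).
  apply: emeasurable_funD => //.
  by apply/measurable_EFinP; exact: measurable_funD.
have a_int0 w : (0 <= \int[lebesgue_measure]_(t in `[0%R, T]) (a t w)%:E)%E.
  by apply: integral_ge0 => t /=; rewrite in_itv/= lee_fin => /andP[]; exact: a0.
have XB w : ((x0 + B T w)%:E <= XT B T x0 a w)%E by rewrite leeDl.
have XNy w : (-oo < XT B T x0 a w)%E by rewrite (lt_le_trans _ (XB w))// ltNyr.
have Xy : {ae P, forall w, (XT B T x0 a w < +oo)%E}.
  have := ae_integral_control_lty P T a ma a0 1 ltr01 (aexp 1 ltr01).
  by apply: filterS => w; rewrite /XT; apply: lte_add_pinfty; rewrite ltry.
apply: exp_utility_hoelder => //.
(* What remains is the finiteness of the expectation of [p]. The factors carrying [B T] and [W] are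
   separated by [x * y <= x ^+ 2 + y ^+ 2], whence the doubled exponents in [b] and [c]. *)
pose b w := (expR (- (2 * gP) * x0) * expR (- (2 * gP) * B T w))%R.
pose c w := expR (2 * gP * W w).
have mb : measurable_fun setT b.
  by apply: measurable_funM => //; apply: measurableT_comp => //; exact: measurable_funM.
have mc : measurable_fun setT c.
  by apply: measurableT_comp => //; exact: measurable_funM.
apply: (@le_lt_trans _ _ (\int[P]_w ((b w)%:E + (c w)%:E)))%E.
  apply: ge0_le_integral => //.
  - by move=> w _; exact: expeR_ge0.
  - apply: measurableT_comp; first exact: measurable_expeR.
    apply: measurable_funeM; apply: emeasurable_funB => //.
    exact/measurable_EFinP.
  - by apply: emeasurable_funD; exact/measurable_EFinP.
  (* Since [a >= 0], dropping the drift lowers the state and so increases the exponential. *)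
  - move=> w _; apply: (@le_trans _ _ (expeR (- gP%:E * ((x0 + B T w)%:E - (W w)%:E)))%E).
      rewrite lee_expeR !mulNe leeN2; apply: lee_wpmul2l; last exact: leeB.
      by rewrite lee_fin ltW.
    rewrite -EFinN -EFinB -EFinM/= -EFinD lee_fin.
    have -> : - gP * (x0 + B T w - W w) = - gP * (x0 + B T w) + gP * W w by ring.
    have -> : b w = expR (- gP * (x0 + B T w)) ^+ 2.
      by rewrite /b -expRD -expRM_natl; congr expR; ring.
    have -> : c w = expR (gP * W w) ^+ 2.
      by rewrite /c -expRM_natl; congr expR; ring.
    rewrite expRD; have := sqr_ge0 (expR (- gP * (x0 + B T w)) - expR (gP * W w)).
    have := expR_gt0 (- gP * (x0 + B T w)); have := expR_gt0 (gP * W w).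
    nra.
rewrite ge0_integralD//; last 4 first.
- by move=> w _; rewrite lee_fin mulr_ge0 ?expR_ge0.
- exact/measurable_EFinP.
- by move=> w _; rewrite lee_fin expR_ge0.
- exact/measurable_EFinP.
(* The moment of [W] of order [2 * gP] bounds [c]; the Gaussian moment of [B T] is left for [b]. *)
rewrite lte_add_pinfty//; last by apply: Wexp; rewrite mulf_neq0 ?gt_eqF.
under eq_integral do rewrite EFinM.
rewrite ge0_integralZl//; last first.
  by apply/measurable_EFinP/measurableT_comp => //; exact: measurable_funM.
rewrite lte_mul_pinfty ?lee_fin ?expR_ge0//.
exact: brownian_expR_integrable.
Qed.
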